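(* Let $X^{\mathrm{in}}\subseteq\mathbb{R}^d$ be nonempty, let $T:\mathbb{R}^d\to\mathbb{R}^d$ be a nonzero map, and let $\varphi:\mathbb{R}^d\to\mathbb{R}$ satisfy $\varphi(0)=0$. For $k\in\mathbb{N}$ let $\nu_k:=\sup\{\varphi(T^k(x)) : x\in X^{\mathrm{in}}\}$, and assume that $\nu_k$ is finite for every $k\in\mathbb{N}$; write $\nu=(\nu_k)_{k\in\mathbb{N}}$. Suppose that $X^{\mathrm{in}}$ is bounded and not reduced to $\{0\}$, and that there exists a Lyapunov function $V$ for $T$ on some $\mathcal{D}\in\operatorname{Sta}(T)$ such that $X^{\mathrm{in}}\subseteq\mathcal{D}$. If $$\varphi(x)\leq V(x)\quad\text{for all }x\in\mathcal{D},$$ then: 1. $\limsup_{n\to+\infty}\nu_n\leq 0$; and if, moreover, there exist $k\in\mathbb{N}$ and $x\in X^{\mathrm{in}}$ with $\varphi(T^k(x))>0$, then the set $\{k\in\mathbb{N} : \nu_k>\limsup_{n\to+\infty}\nu_n\}$ is nonempty. 2. The function $h:\mathbb{R}_+\ni s\mapsto s\,\sup_{x\in X^{\mathrm{in}}}V(x)$ satisfies $h\in\Gamma_{\mathrm{fun}}(\nu)$ and $N_T^{\mathcal{D}}(V)\in\Gamma_{\mathrm{sc}}(\nu,h)$; and if, moreover, there exist $k\in\mathbb{N}$ and $x\in X^{\mathrm{in}}$ with $\varphi(T^k(x))>0$, then $h$ is useful for $\nu$.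
   Context: $\mathbb{N}$ includes $0$; $\mathbb{R}_+=[0,+\infty)$; $\|\cdot\|$ is the Euclidean norm on $\mathbb{R}^d$; $T^k$ is the $k$-fold composition of $T$, with $T^0=\mathrm{Id}$. A function $\alpha:[0,a)\to\mathbb{R}_+$ (for some $a>0$, possibly $a=+\infty$) belongs to $\mathcal{K}$ if it is strictly increasing and continuous on $[0,a)$ and $\alpha(0)=0$. Stable sets. For $F:\mathbb{R}^d\to\mathbb{R}^d$, $\operatorname{Sta}(F):=\{\mathcal{D}\subseteq\mathbb{R}^d : \mathcal{D}\text{ closed},\ 0\in\mathcal{D},\ \mathcal{D}\neq\{0\},\ F(\mathcal{D})\subseteq\mathcal{D}\}$. Lyapunov functions. A function $V:\mathbb{R}^d\to\mathbb{R}$ is a (local) Lyapunov function for $F$ on $X\in\operatorname{Sta}(F)$ if (i) there exist $\alpha_1,\alpha_2\in\mathcal{K}$ (whose domains contain $\{\|x\| : x\in X\}$) such that $\alpha_1(\|x\|)\leq V(x)\leq\alpha_2(\|x\|)$ for all $x\in X$; and (ii) there exists $\lambda\in(0,1)$ such that $V(F(x))\leq\lambda V(x)$ for all $x\in X$. Ratio operator. For $F:\mathbb{R}^d\to\mathbb{R}^d$ with $F(0)=0$, $X\in\operatorname{Sta}(F)$ and $W$ nonnegative on $X$ vanishing on $X$ exactly at $0$, $N_F^X(W):=\sup_{x\in X,\,x\neq0}\dfrac{W(F(x))}{W(x)}\in[0,+\infty]$. (A Lyapunov function $V$ for $F$ on $X$ is nonnegative on $X$ and vanishes there exactly at $0$,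 and its existence forces $F(0)=0$.) Upper-bounding pairs. $\Omega([0,1])$ is the set of functions $h:\mathbb{R}\to\mathbb{R}$ that are strictly increasing and continuous on $[0,1]$; such a function may be given only on a set containing $[0,1]$ (e.g. $\mathbb{R}_+$), its extension to $\mathbb{R}$ being arbitrary. For a real sequence $u=(u_k)_{k\in\mathbb{N}}$, $\Gamma(u):=\{(h,\beta)\in\Omega([0,1])\times(0,1) : u_k\leq h(\beta^k)\ \forall k\in\mathbb{N}\}$, $\Gamma_{\mathrm{fun}}(u):=\{h\in\Omega([0,1]) : \exists\beta\in(0,1),\ (h,\beta)\in\Gamma(u)\}$, and, for $h\in\Gamma_{\mathrm{fun}}(u)$, $\Gamma_{\mathrm{sc}}(u,h):=\{\beta\in(0,1) : (h,\beta)\in\Gamma(u)\}$. For $u$ bounded above with $\{k : u_k>\limsup_{n\to+\infty}u_n\}\neq\emptyset$, $h\in\Gamma_{\mathrm{fun}}(u)$ is called useful for $u$ if $\{k\in\mathbb{N} : u_k>h(0)\}\neq\emptyset$.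
   Formalization: The claim that N_T^D(V) lies in Γ_sc(ν,h) is stated only when T is not identically zero on D: if T vanishes on D but not on R^d, then N_T^D(V)=0, which is not in (0,1), so the claim fails there. *)

(* Defs.v *)
From mathcomp Require Import all_boot all_order all_algebra.
From mathcomp Require Import all_classical all_reals all_analysis.

Set Implicit Arguments.
Unset Strict Implicit.
Unset Printing Implicit Defensive.

Import Order.TTheory GRing.Theory Num.Theory.
Import numFieldNormedType.Exports.

Local Open Scope classical_set_scope.
Local Open Scope ring_scope.

(* The library's norm `|x| on 'rV[R]_d is the sup norm; it induces the same
   closed sets and the same bounded sets as this one. *)
Definition enorm (R : realType) (d : nat) (x : 'rV[R]_d) : R :=
  Num.sqrt (\sum_(i < d) x ord0 i ^+ 2).

Definition Kdomain (R : realType) (a : \bar R) : set R :=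
  [set s | 0 <= s /\ (s%:E < a)%E].

(* [alpha] restricted to [0, a) is of class K; its values outside [0, a) are
   irrelevant. *)
Definition classK (R : realType) (a : \bar R) (alpha : R -> R) : Prop :=
  [/\ (0 < a)%E,
      forall s, Kdomain a s -> 0 <= alpha s,
      forall s t, Kdomain a s -> Kdomain a t -> s < t -> alpha s < alpha t,
      {within Kdomain a, continuous alpha} &
      alpha 0 = 0].

Definition Sta (R : realType) (d : nat) (F : 'rV[R]_d -> 'rV[R]_d) :
    set (set 'rV[R]_d) :=
  [set D : set 'rV[R]_d | [/\ closed D, D 0, D <> [set 0] & F @` D `<=` D]].

Definition lyapunov (R : realType) (d : nat) (F : 'rV[R]_d -> 'rV[R]_d)
    (X : set 'rV[R]_d) (V : 'rV[R]_d -> R) : Prop :=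
  (exists a1 a2 : \bar R, exists alpha1 alpha2 : R -> R,
    [/\ classK a1 alpha1, classK a2 alpha2,
        (@enorm R d) @` X `<=` Kdomain a1, (@enorm R d) @` X `<=` Kdomain a2 &
        forall x, X x -> alpha1 (enorm x) <= V x <= alpha2 (enorm x)]) /\
  (exists lambda : R,
    0 < lambda < 1 /\ forall x, X x -> V (F x) <= lambda * V x).

Definition ratio_op (R : realType) (d : nat) (F : 'rV[R]_d -> 'rV[R]_d)
    (X : set 'rV[R]_d) (W : 'rV[R]_d -> R) : \bar R :=
  ereal_sup [set (W (F x) / W x)%:E | x in X `\ 0].

Definition Omega01 (R : realType) : set (R -> R) :=
  [set h : R -> R | {in `[0, 1] &, {homo h : s t / s < t}} /\
           {within `[0, 1], continuous h}].

Definition Gamma (R : realType) (u : R^nat) : set ((R -> R) * R) :=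
  [set p : (R -> R) * R |
    [/\ Omega01 p.1, 0 < p.2 < 1 & forall k, u k <= p.1 (p.2 ^+ k)]].

Definition Gamma_fun (R : realType) (u : R^nat) : set (R -> R) :=
  [set h | Omega01 h /\ exists2 beta : R, 0 < beta < 1 & Gamma u (h, beta)].

Definition Gamma_sc (R : realType) (u : R^nat) (h : R -> R) : set R :=
  [set beta : R | 0 < beta < 1 /\ Gamma u (h, beta)].

(* The limit superior may be -oo, hence is taken in the extended reals. *)
Definition limsup (R : realType) (u : R^nat) : \bar R :=
  limn_esup (EFin \o u).

Definition above_limsup (R : realType) (u : R^nat) : set nat :=
  [set k | (limsup u < (u k)%:E)%E].

(* The first three clauses are the conditions under which usefulness is
   defined. *)
Definition useful (R : realType) (u : R^nat) (h : R -> R) : Prop :=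
  [/\ has_ubound (range u), above_limsup u !=set0, Gamma_fun u h &
      [set k | h 0 < u k] !=set0].

(* Main.v *)
Require Import Defs.
From mathcomp Require Import all_boot all_order all_algebra.
From mathcomp Require Import all_classical all_reals all_analysis.

Set Implicit Arguments.
Unset Strict Implicit.
Unset Printing Implicit Defensive.

Import Order.TTheory GRing.Theory Num.Theory.
Import numFieldNormedType.Exports.

Local Open Scope classical_set_scope.
Local Open Scope ring_scope.

(** A contraction factor [b] of [V] along [T] propagates to the iterates, so
    that [phi (T^k x) <= V (T^k x) <= b ^ k * V x <= b ^ k * M] on [Xin], where
    [M = sup (V @` Xin)].  Hence [nu k <= h (b ^ k)] for the linear function
    [h s = s * M], and all the conclusions follow from this geometric bound:
    it tends to [0], so [limsup nu <= 0], while a positive value of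
    [phi (T^k x)] puts [nu k] above both [h 0 = 0] and the limit superior.

    Three facts make this work.
    - [M] is finite ([lyapunov_bounded]).  The comparison function [alpha2] may
      blow up at the finite end of its domain, so boundedness of [Xin] alone
      does not suffice; but [Xin] lies in a compact part of the closed set [D],
      where the Euclidean norm attains its maximum, and this maximum still
      belongs to the domain of [alpha2].
    - [M] is positive, since [Xin] contains a nonzero point and [V] is positive
      there ([lyapunov_gt0]); this makes [h] strictly increasing.
    - The ratio [N_T^D (V)] is itself a contraction factor in [(0, 1)]
      ([ratio_op_contraction]): it is at most the factor given by the
      definition of a Lyapunov function, and it is positive once [T] does not
      vanish identically on [D].  The geometric bound
      [contraction_Gamma] therefore holds with this ratio as well. *)

(** * The Euclidean norm and comparison functions *)

Section EuclideanNorm.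
Context {R : realType} {d : nat}.
Implicit Type x : 'rV[R]_d.

Lemma enorm0 : enorm (0 : 'rV[R]_d) = 0.
Proof. by rewrite /enorm big1 ?sqrtr0// => i _; rewrite mxE expr0n. Qed.

Lemma enorm_gt0 x : x != 0 -> 0 < enorm x.
Proof.
move=> x0; rewrite /enorm sqrtr_gt0 lt_neqAle sumr_ge0 ?andbT; last first.
  by move=> i _; exact: sqr_ge0.
rewrite eq_sym; apply: contra x0 => /eqP sum0; apply/eqP/rowP => i.
rewrite mxE; apply/eqP; rewrite -sqrf_eq0; apply/eqP.
have sq_ge0 (j : 'I_d) : true -> 0 <= x ord0 j ^+ 2 by move=> _; exact: sqr_ge0.
exact: (psumr_eq0P sq_ge0 sum0).
Qed.

Lemma enorm_continuous : continuous (@enorm R d).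
Proof.
move=> x; rewrite /enorm.
apply: (@continuous_comp _ _ _ (fun y : 'rV[R]_d => \sum_(i < d) y ord0 i ^+ 2)
  Num.sqrt); last exact: sqrt_continuous.
apply: continuous_big => [|i _]; first exact: add_continuous.
move=> {}x; apply: (@continuous_comp _ _ _ (fun y : 'rV[R]_d => y ord0 i)
  (fun t : R => t ^+ 2)); first exact: coord_continuous.
exact: exprn_continuous.
Qed.

End EuclideanNorm.

Section ClassK.
Context {R : realType} (a : \bar R) (alpha : R -> R).
Hypothesis aK : classK a alpha.

Lemma classK_le s t :
  Kdomain a s -> Kdomain a t -> s <= t -> alpha s <= alpha t.
Proof.
case: aK => _ _ inc _ _ sa ta; rewrite le_eqVlt => /predU1P[->//|st].
exact/ltW/inc.
Qed.

Lemma classK_gt0 s : Kdomain a s -> 0 < s -> 0 < alpha s.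
Proof.
by case: aK => a0 _ inc _ alpha0 sa s0; rewrite -alpha0; apply: inc.
Qed.

End ClassK.

(** * Lyapunov functions on a stable set *)

Section Lyapunov.
Context {R : realType} {d : nat} (F : 'rV[R]_d -> 'rV[R]_d).
Context (X : set 'rV[R]_d) (V : 'rV[R]_d -> R).
Hypotheses (X_Sta : Sta F X) (V_lyap : lyapunov F X V).

Lemma lyapunov_gt0 x : X x -> x != 0 -> 0 < V x.
Proof.
case: V_lyap => -[a1 [a2 [alpha1 [alpha2 [K1 _ dom1 _ bnd]]]]] _ Xx x0.
have /andP[le1 _] := bnd _ Xx; apply: lt_le_trans le1.
by apply: (classK_gt0 K1); [apply: dom1; exists x|exact: enorm_gt0].
Qed.

Lemma lyapunov0 : V 0 = 0.
Proof.
case: X_Sta => _ X0 _ _.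
case: V_lyap => -[a1 [a2 [al1 [al2 [[_ _ _ _ al10] [_ _ _ _ al20] _ _ bnd]]]]] _.
by have := bnd _ X0; rewrite enorm0 al10 al20 -eq_le => /eqP.
Qed.

Lemma Sta_iter k x : X x -> X (iter k F x).
Proof.
case: X_Sta => _ _ _ FX Xx; elim: k => //= k IHk.
by apply: FX; exists (iter k F x).
Qed.

(** Decrease forces [V (F 0) <= 0], and [V] is positive off the origin. *)
Lemma lyapunov_fix0 : F 0 = 0.
Proof.
case: (X_Sta) => _ X0 _ _; apply/eqP/negPn/negP => F0.
case: V_lyap => _ [l [_ /(_ _ X0)]]; rewrite lyapunov0 mulr0 leNgt.
by rewrite lyapunov_gt0//; exact: (Sta_iter 1 X0).
Qed.

Lemma contraction_iter (b : R) k x :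
  0 <= b -> (forall y, X y -> V (F y) <= b * V y) ->
  X x -> V (iter k F x) <= b ^+ k * V x.
Proof.
move=> b0 bV Xx; elim: k => [|k IHk]; first by rewrite expr0 mul1r.
rewrite iterS exprS -mulrA (le_trans (bV _ (Sta_iter k Xx)))//.
exact: ler_wpM2l.
Qed.

(** Maximising the norm over the compact set [K] rather than over [A] yields a
    radius [enorm c] attained at a point of [X], hence inside the domain of
    the upper comparison function. *)
Lemma lyapunov_bounded (A : set 'rV[R]_d) :
  A `<=` X -> bounded_set A -> has_ubound (V @` A).
Proof.
move=> AX [M [Mreal AM]].
case: X_Sta => clX X0 _ _.
(* The bound [`|x| <= s] on [A] is available only for [s] above [M]. *)
pose r := `|M| + 1.
pose K := X `&` [set x : 'rV[R]_d | `|x| <= r].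
have K0 : K !=set0 by exists 0; split => //=; rewrite normr0 addr_ge0.
have cK : compact K.
  apply: bounded_closed_compact.
    exists r; split; first exact: num_real.
    by move=> s rs x [_ /= xr]; exact: (le_trans xr (ltW rs)).
  apply: closedI => //.
  apply: (@preimage_closed _ _ (fun x : 'rV[R]_d => `|x|) [set s : R | s <= r]).
    by move=> x _; exact: norm_continuous.
  exact: closed_le.
have AK : A `<=` K.
  move=> x Ax; split; first exact: AX.
  apply: (AM r) => //; rewrite /r; apply: (le_lt_trans (ler_norm M)).
  by rewrite ltrDl.
have [c Kc maxc] :=
  EVT_max_rV K0 cK (continuous_subspaceT (A := K) enorm_continuous).
have {Kc} [Xc _] : K c by rewrite inE in Kc.
case: V_lyap => -[a1 [a2 [alpha1 [alpha2 [_ K2 _ dom2 bnd]]]]] _.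
exists (alpha2 (enorm c)) => _ [x Ax <-].
have /andP[_ le2] := bnd _ (AX _ Ax); apply: (le_trans le2).
apply: (classK_le K2); [by apply: dom2; exists x => //; exact: AX|
  by apply: dom2; exists c|].
by apply: maxc; rewrite inE; exact: AK.
Qed.

(** The supremum is over a nonempty set of numbers at most [lambda].  It is
    positive because a point [x] of [X] with [F x <> 0] cannot be the origin,
    which [F] fixes, so that [V (F x) / V x] is one of the positive ratios. *)
Lemma ratio_op_contraction : (exists2 x, X x & F x != 0) ->
  exists2 b : R, ratio_op F X V = b%:E &
    0 < b < 1 /\ forall x, X x -> V (F x) <= b * V x.
Proof.
move=> [x0 Xx0 Fx0].
have x0_neq0 : x0 != 0.
  by apply: contra Fx0 => /eqP ->; rewrite lyapunov_fix0.
have [_ [l [/andP[l0 l1] lV]]] := V_lyap.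
have le_l : (ratio_op F X V <= l%:E)%E.
  apply: ge_ereal_sup => _ [x [Xx /eqP xn0] <-].
  by rewrite lee_fin ler_pdivrMr ?lyapunov_gt0// lV.
have ge_ratio x : X x -> x != 0 -> ((V (F x) / V x)%:E <= ratio_op F X V)%E.
  by move=> Xx xn0; apply: ereal_sup_ubound; exists x => //; split=> //; exact/eqP.
have ratio_gt0 : (0 < ratio_op F X V)%E.
  apply: lt_le_trans (ge_ratio _ Xx0 x0_neq0); rewrite lte_fin divr_gt0//.
    by apply: lyapunov_gt0 => //; exact: (Sta_iter 1 Xx0).
  exact: lyapunov_gt0.
case: (ratio_op F X V) le_l ge_ratio ratio_gt0 => [b| |]//.
rewrite lee_fin lte_fin => bl ge_ratio b0; exists b => //; split.
  by rewrite b0 (le_lt_trans bl l1).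
move=> x Xx; have [->|xn0] := eqVneq x 0.
  by rewrite lyapunov_fix0 lyapunov0 mulr0.
by have := ge_ratio _ Xx xn0; rewrite lee_fin ler_pdivrMr ?lyapunov_gt0.
Qed.

End Lyapunov.

(** * Geometric bounds *)

Lemma Omega01_mulr (R : realType) (c : R) :
  0 < c -> Omega01 (fun s : R => s * c).
Proof.
move=> c0; split; first by move=> s t _ _ st; rewrite ltr_pM2r.
by apply: continuous_subspaceT => x; apply: cvgM => //; exact: cvg_cst.
Qed.

(** The geometric bound is nonincreasing, so it also bounds the suprema of the
    tails of [u], whose limit is the limit superior. *)
Lemma limsup_geometric_le0 (R : realType) (u : R^nat) (b c : R) :
  0 < b < 1 -> 0 <= c -> (forall k, u k <= b ^+ k * c) -> (limsup u <= 0)%E.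
Proof.
move=> /andP[b0 b1] c0 ub; rewrite /limsup limn_esup_lim.
have cvg0 : EFin \o geometric c b @ \oo --> 0%E.
  apply: cvg_EFin; first exact: nearW.
  by apply: cvg_geometric; rewrite ger0_norm ?ltW.
rewrite -(cvg_lim _ cvg0)//; apply: lee_lim.
- exact: is_cvg_esups.
- by apply/cvg_ex; exists 0%E.
apply: nearW => n; apply: ge_ereal_sup => _ [m /= nm <-].
rewrite lee_fin (le_trans (ub m))// mulrC ler_wpM2l//.
by rewrite ler_wiXn2l ?ltW.
Qed.

(** Stated for an arbitrary contraction factor, so as to serve both for the
    factor in the definition of a Lyapunov function and for the ratio. *)
Lemma contraction_Gamma (R : realType) (d : nat) (Xin D : set 'rV[R]_d)
    (T : 'rV[R]_d -> 'rV[R]_d) (phi V : 'rV[R]_d -> R) (nu : R^nat) (b : R) :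
  Sta T D -> Xin `<=` D ->
  (forall k, ereal_sup [set (phi (iter k T x))%:E | x in Xin] = (nu k)%:E) ->
  (forall x, D x -> phi x <= V x) ->
  has_ubound (V @` Xin) -> 0 < sup (V @` Xin) ->
  0 < b < 1 -> (forall x, D x -> V (T x) <= b * V x) ->
  Gamma nu (fun s : R => s * sup (V @` Xin), b).
Proof.
move=> D_Sta XinD nuE phi_le_V ubV M0 b01 bV; split => //=.
  exact: Omega01_mulr.
have /andP[/ltW b0 _] := b01.
move=> k; rewrite -lee_fin -nuE; apply: ge_ereal_sup => _ [x Xx <-].
have Dx := XinD _ Xx; rewrite lee_fin.
apply: (le_trans (phi_le_V _ (Sta_iter D_Sta k Dx))).
apply: (le_trans (contraction_iter D_Sta k b0 bV Dx)).
rewrite ler_wpM2l ?exprn_ge0//.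
by apply: ub_le_sup => //; exists x.
Qed.

Theorem theorem6 (R : realType) (d : nat)
    (Xin : set 'rV[R]_d) (T : 'rV[R]_d -> 'rV[R]_d) (phi : 'rV[R]_d -> R)
    (nu : R^nat) (D : set 'rV[R]_d) (V : 'rV[R]_d -> R)
    (Xin_neq0 : Xin !=set0)
    (T_neq0 : exists x, T x != 0)
    (phi0 : phi 0 = 0)
    (nuE : forall k,
       ereal_sup [set (phi (iter k T x))%:E | x in Xin] = (nu k)%:E)
    (Xin_bounded : bounded_set Xin)
    (Xin_not0 : Xin <> [set 0])
    (D_Sta : Sta T D)
    (V_lyap : lyapunov T D V)
    (XinD : Xin `<=` D)
    (phi_le_V : forall x, D x -> phi x <= V x) :
  let h := fun s : R => s * sup (V @` Xin) in
  let phi_pos := exists k, exists2 x, Xin x & 0 < phi (iter k T x) in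
  ((limsup nu <= 0)%E /\ (phi_pos -> above_limsup nu !=set0)) /\
  [/\ Gamma_fun nu h,
      (exists2 x, D x & T x != 0) ->
        exists2 beta : R, ratio_op T D V = beta%:E & Gamma_sc nu h beta &
      phi_pos -> useful nu h].
Proof.
move=> h phi_pos.
have ubV : has_ubound (V @` Xin) by exact: (lyapunov_bounded D_Sta V_lyap).
have [x Xx x0] : exists2 x, Xin x & x != 0.
  apply: contrapT => noX; apply: Xin_not0; have [y Xy] := Xin_neq0.
  have Xin0 z : Xin z -> z = 0.
    by move=> Xz; apply/eqP/negPn/negP => z0; apply: noX; exists z.
  apply/seteqP; split=> [z /Xin0//|_ ->].
  by rewrite -(Xin0 y Xy).
have M0 : 0 < sup (V @` Xin).
  apply: (lt_le_trans (lyapunov_gt0 V_lyap (XinD _ Xx) x0)).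
  by apply: ub_le_sup => //; exists x.
have GammaP b : 0 < b < 1 -> (forall y, D y -> V (T y) <= b * V y) ->
    Gamma nu (h, b).
  exact: (contraction_Gamma D_Sta XinD nuE phi_le_V ubV M0).
have [_ [l [l01 lV]]] := V_lyap.
have Gl := GammaP _ l01 lV.
have [Oh _ nu_le] := Gl.
have Gfun : Gamma_fun nu h by split => //; exists l.
have limsup_le0 : (limsup nu <= 0)%E.
  exact: (limsup_geometric_le0 l01 (ltW M0) nu_le).
have nu_gt0 : phi_pos -> exists k, 0 < nu k.
  move=> [k [y Xy phi_gt0]]; exists k; rewrite -lte_fin -nuE.
  apply: lt_le_trans (_ : ((phi (iter k T y))%:E <= _)%E).
    by rewrite lte_fin.
  by apply: ereal_sup_ubound; exists y.
have above : phi_pos -> above_limsup nu !=set0.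
  move=> /nu_gt0[k nuk]; exists k; apply: (le_lt_trans limsup_le0).
  by rewrite lte_fin.
split => //; split => //.
  move=> /(ratio_op_contraction D_Sta V_lyap)[b Eb [b01 bV]].
  by exists b => //; split => //; exact: GammaP.
move=> pos; split=> //; [|exact: above|]; last first.
  by have [k nuk] := nu_gt0 pos; exists k; rewrite /= /h mul0r.
exists (sup (V @` Xin)) => _ [k _ <-]; apply: (le_trans (nu_le k)).
have /andP[/ltW l0 /ltW l1] := l01.
by rewrite /= /h ler_piMl ?exprn_ile1// ltW.
Qed.
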